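(* For all integers $D\ge 4$ there exists an edge $e$ of the Kautz digraph $K(2,D)$ such that $\mathrm{cong}(e)>\tau(2,D)$, where $\tau(2,D)=(D-1)2^{D-2}+D\,2^{D-1}$.
   Context: The Kautz digraph $K(2,D)$ has as vertices all words $x_0\cdots x_{D-1}$ of length $D$ over $\{0,1,2\}$ with $x_i\ne x_{i+1}$ for all $i$, and directed edges $x_0x_1\cdots x_{D-1}\to x_1\cdots x_{D-1}x_D$ for $x_D\in\{0,1,2\}\setminus\{x_{D-1}\}$. Every ordered pair of distinct vertices is joined by a unique shortest directed path (geodesic). For an edge $e$, $\mathrm{cong}(e)$ is the number of ordered pairs $(x,y)$ of distinct vertices whose unique geodesic from $x$ to $y$ uses $e$. *)

(* Defs.v *)
From mathcomp Require Import all_boot.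
From mathcomp Require Import boolp.

Set Implicit Arguments.
Unset Strict Implicit.
Unset Printing Implicit Defensive.

(* A directed walk from x is given by its list p of successive vertices after
   x, as in [path]; its length is [size p]. *)
Definition geodesic (V : eqType) (r : rel V) (x y : V) (p : seq V) : Prop :=
  [/\ path r x p, last x p = y &
      forall q : seq V, path r x q -> last x q = y -> size p <= size q].

(* [zip (x :: p) p] is the list of edges (x, p_0), (p_0, p_1), ... of the walk,
   since [zip] drops the unmatched final vertex. *)
Definition uses_edge (V : eqType) (e : V * V) (x : V) (p : seq V) : bool :=
  e \in zip (x :: p) p.

(* Geodesics of the Kautz digraph are unique, so "the geodesic uses e" is
   rendered as "some geodesic uses e". *)
Definition cong (V : finType) (r : rel V) (e : V * V) : nat :=
  #|[set xy : V * V | (xy.1 != xy.2) &&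
      `[< exists p : seq V,
            geodesic r xy.1 xy.2 p /\ uses_edge e xy.1 p >]]|.

Definition kautz_word (w : seq 'I_3) : bool :=
  sorted (fun a b : 'I_3 => a != b) w.

Definition kautz (D : nat) : finType :=
  {w : D.-tuple 'I_3 | kautz_word w}.

(* The default value [ord0] of [last] only matters when D = 0. *)
Definition kautz_arc (D : nat) : rel (kautz D) :=
  fun x y => [exists a : 'I_3,
    (a != last ord0 (val x)) && (tval (val y) == rcons (behead (val x)) a)].

Definition tau (D : nat) : nat := (D - 1) * 2 ^ (D - 2) + D * 2 ^ (D - 1).

(* Main.v *)
(* A walk of length k <= D through the edge e = e_0 ... e_D is a word
   z = L e R of length D + k, with |L| = a, |R| = b and a + b + 1 = k, so there
   are 2^(a+b) of them, and (D-1) 2^D + 1 = tau + (D-3) 2^(D-2) + 1 in all.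
   Such a walk fails to be a geodesic only if, for some 1 <= p <= k, the word z
   has period p on the positions from k - p to D + p - 1. This forces a
   repetition of period p inside e, and determines the p - 1 - b letters to the
   left of e and the p - 1 - a letters to its right. It remains to choose e with
   few repetitions. We take a prefix of the Thue-Morse ternary word with its
   first letter replaced so that it begins with 212, a factor which does not
   occur in the Thue-Morse word (for D = 4, 5, another factor of that word).
   This e is square-free, so p must exceed a + 1 or b + 1: a prefix or a suffix
   of e recurs at distance p without overlap, or, when p exceeds both, e has a
   short border. Recurring prefixes have at most two letters, recurring suffixes
   at most D/2, and two occurrences of the same one do not overlap. Summing
   geometric series gives at most (D-3) 2^(D-2) failures when D >= 25; for
   D < 25 the bound is computed. *)
From Stdlib Require Import NArith.
Require Import Defs.
From mathcomp Require Import all_boot.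
From mathcomp Require Import boolp zmodp zify.

Set Implicit Arguments.
Unset Strict Implicit.
Unset Printing Implicit Defensive.

(** * Walks as letter sequences *)

Definition proper (f : nat -> 'I_3) := forall n, f n != f n.+1.

Lemma kautz_word_map (f : nat -> 'I_3) (pf : proper f) i n :
  kautz_word (map f (iota i n)).
Proof.
rewrite /kautz_word; case: n => //= n.
by elim: n i => //= n IHn i; rewrite pf IHn.
Qed.

Lemma size_map_iota (f : nat -> 'I_3) i n : size (map f (iota i n)) == n.
Proof. by rewrite size_map size_iota. Qed.

(** Walks slide a window along one infinite word, so that vertices are indexed by plain integers and
    every overlap of two vertices is a statement about letters of that word. *)
Definition window D (f : nat -> 'I_3) (pf : proper f) i : kautz D :=
  exist _ (Tuple (size_map_iota f i D)) (kautz_word_map pf i D).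

Lemma nth_window D f (pf : proper f) i n :
  n < D -> nth ord0 (val (window D pf i)) n = f (i + n).
Proof. by move=> ltnD; rewrite (nth_map 0) ?size_iota // nth_iota. Qed.

Lemma kautz_eqP D (x y : kautz D) :
  (forall n, n < D -> nth ord0 (val x) n = nth ord0 (val y) n) -> x = y.
Proof.
move=> eqxy; apply/val_inj/val_inj/(@eq_from_nth _ ord0) => [|n].
  by rewrite !size_tuple.
by rewrite size_tuple => /eqxy.
Qed.

Lemma kautz_arc_window D f (pf : proper f) i :
  0 < D -> kautz_arc (window D pf i) (window D pf i.+1).
Proof.
case: D => // D _; apply/existsP; exists (f (i + D.+1)).
apply/andP; split.
  rewrite /= (last_nth ord0) size_map size_iota; case: D => [|D].
    by rewrite /= addn1 eq_sym pf.
  rewrite [nth _ _ _](nth_map 0) ?size_iota // nth_iota //.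
  by rewrite [in f (i + _)]addnS eq_sym addSnnS pf.
apply/eqP; transitivity (map f (iota i.+1 (D + 1))); first by rewrite addn1.
by rewrite iotaD map_cat cats1 addSnnS.
Qed.

Lemma path_window D f (pf : proper f) i k : 0 < D ->
  path (@kautz_arc D) (window D pf i) (map (window D pf) (iota i.+1 k)).
Proof.
by move=> D_gt0; elim: k i => //= k IHk i; rewrite kautz_arc_window //=.
Qed.

Lemma last_window D f (pf : proper f) i k :
  last (window D pf i) (map (window D pf) (iota i.+1 k)) = window D pf (i + k).
Proof. by elim: k i => [|k IHk] i /=; rewrite ?addn0 // IHk addSnnS. Qed.

Lemma uses_edge_window D f (pf : proper f) i k a : a < k ->
  uses_edge (window D pf (i + a), window D pf (i + a).+1) (window D pf i)
            (map (window D pf) (iota i.+1 k)).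
Proof.
rewrite /uses_edge; elim: k i a => //= k IHk i [|a] lt_ak.
  by rewrite addn0 mem_head.
by rewrite in_cons -addSnnS IHk ?orbT.
Qed.

(** Each arc drops one letter on the left, so the final letters of [x] survive at the front of the
    endpoint. This is how a shorter walk yields a period. *)
Lemma nth_last_path D (x : kautz D) p : path (@kautz_arc D) x p ->
  forall n, n + size p < D ->
  nth ord0 (val (last x p)) n = nth ord0 (val x) (n + size p).
Proof.
elim: p x => [|y p IHp] x /=; first by move=> _ n; rewrite addn0.
case/andP=> /existsP[c /andP[_ /eqP def_y]] yp n.
rewrite addnS => ltnD; rewrite IHp ?(ltnW ltnD) // def_y nth_rcons.
by rewrite size_behead size_tuple ltn_predRL ltnD nth_behead.
Qed.

(** * Coding of the walks through an edge by binary choices *)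

Definition step (x : 'I_3) (c : bool) : 'I_3 := inZp (x + 1 + c).

Lemma step_neq x c : step x c != x.
Proof. by case: x c => [[|[|[|]]] ?] []. Qed.

Lemma step_inj x : injective (step x).
Proof. by case: x => [[|[|[|]]] ?] [] []. Qed.

Fixpoint run (x : 'I_3) (c : nat -> bool) (n : nat) : 'I_3 :=
  if n is m.+1 then step (run x c m) (c m) else x.

Lemma run_inj x c d m : (forall i, i <= m -> run x c i = run x d i) ->
  forall i, i < m -> c i = d i.
Proof.
move=> eq_run i lt_im; apply: (@step_inj (run x c i)).
by rewrite [in RHS]eq_run ?(ltnW lt_im) //; exact: (eq_run i.+1).
Qed.

Section Walk.
Variables (D : nat) (e : nat -> 'I_3) (a : nat) (l r : nat -> bool).

(* The letters to the left of e are indexed by their distance to e_0, so [l] and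
   [r] both encode choices made while moving away from e. *)
Definition walk n :=
  if n <= a then run (e 0) l (a - n)
  else if n <= a + D then e (n - a) else run (e D) r (n - (a + D)).

Lemma walk_left j : j <= a -> walk (a - j) = run (e 0) l j.
Proof. by move=> le_ja; rewrite /walk leq_subr subKn. Qed.

Lemma walk_mid j : j <= D -> walk (a + j) = e j.
Proof.
rewrite /walk; case: j => [|j] lejD; first by rewrite addn0 leqnn subnn.
by rewrite ifN ?ifT; try lia; congr e; lia.
Qed.

Lemma walk_right j : walk (a + D + j) = run (e D) r j.
Proof.
case: j => [|j]; first by rewrite addn0 walk_mid.
by rewrite /walk !ifN; try lia; congr run; lia.
Qed.

Lemma walk_proper : proper e -> proper walk.
Proof.
move=> pe n; have [lt_na|le_an] := ltnP n a.
  have -> : n = a - (a - n.+1).+1 by lia.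
  have -> : (a - (a - n.+1).+1).+1 = a - (a - n.+1) by lia.
  by rewrite !walk_left; try lia; apply: step_neq.
have [lt_nD|le_Dn] := ltnP n (a + D).
  have -> : n = a + (n - a) by lia.
  by rewrite -addnS !walk_mid ?pe //; lia.
have -> : n = a + D + (n - (a + D)) by lia.
by rewrite -addnS !walk_right eq_sym step_neq.
Qed.

End Walk.

(* The vertices at distance k along the word z are also joined by a walk of
   length k - p. *)
Definition shortcut D k p (z : nat -> 'I_3) :=
  all (fun n => z n == z (n + p)) (iota (k - p) (D - (k - p))).

Lemma shortcutP D k p z :
  reflect (forall n, k - p <= n < D -> z n = z (n + p)) (shortcut D k p z).
Proof.
apply: (iffP allP) => [sc n lt_nD | sc n].
  by apply/eqP/sc; rewrite mem_iota; lia.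
by rewrite mem_iota => n_in; apply/eqP/sc; lia.
Qed.

Lemma leq_sum_card_disjoint (I T : finType) (P : pred I) (A : I -> {set T})
    (B : {set T}) :
  (forall i, P i -> A i \subset B) ->
  (forall i j x, P i -> P j -> x \in A i -> x \in A j -> i = j) ->
  \sum_(i | P i) #|A i| <= #|B|.
Proof.
move=> sAB disjA.
have -> : \sum_(i | P i) #|A i| = \sum_(x in B) \sum_(i | P i) (x \in A i).
  rewrite exchange_big; apply: eq_bigr => i /sAB /subsetP sAiB.
  rewrite -sum1_card big_mkcond [RHS]big_mkcond.
  apply: eq_bigr => x _; case: (boolP (x \in A i)) => [/sAiB -> | _] //.
  by case: ifP.
rewrite -sum1_card; apply: leq_sum => x _.
case: (pickP (fun i => P i && (x \in A i))) => [i /andP[Pi xAi] | noA].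
  rewrite (bigD1 i) //= xAi big1 ?addn0 // => j /andP[Pj neq_ji].
  by case: (boolP (x \in A j)) => // /(disjA _ _ _ Pi Pj xAi) eq_ij;
    rewrite eq_ij eqxx in neq_ji.
by rewrite big1 // => i Pi; have := noA i; rewrite Pi /= => ->.
Qed.

(** * Walks without shortcut are geodesics with distinct pairs of ends *)

Section Count.
Variables (D : nat) (e : nat -> 'I_3).
Hypotheses (D_gt0 : 0 < D) (pe : proper e).

(** The default [false] only fills letters beyond the [a] left and [b] right ones, which neither end
    vertex contains. *)
Definition twalk a b (s : a.-tuple bool * b.-tuple bool) :=
  walk D e a (nth false s.1) (nth false s.2).

Definition bad a b p : {set a.-tuple bool * b.-tuple bool} :=
  [set s | shortcut D (a + b).+1 p (twalk s)].

Definition good a b : {set a.-tuple bool * b.-tuple bool} :=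
  [set s | ~~ has (fun p => shortcut D (a + b).+1 p (twalk s))
                  (iota 1 (a + b).+1)].

Lemma goodN a b s p : s \in good a b -> 0 < p <= (a + b).+1 ->
  ~ (forall n, (a + b).+1 - p <= n < D -> twalk s n = twalk s (n + p)).
Proof.
rewrite inE => /hasPn good_s p_in /shortcutP; apply/negP/good_s.
by rewrite mem_iota; lia.
Qed.

Lemma twalk_proper a b (s : a.-tuple bool * b.-tuple bool) : proper (twalk s).
Proof. exact: walk_proper. Qed.

Definition ends a b (s : a.-tuple bool * b.-tuple bool) : kautz D * kautz D :=
  (window D (twalk_proper s) 0, window D (twalk_proper s) (a + b).+1).

Lemma twalk_mid a b (s : a.-tuple bool * b.-tuple bool) j :
  j <= D -> twalk s (a + j) = e j.
Proof. exact: walk_mid. Qed.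

Lemma ends_eq a b (s : a.-tuple bool * b.-tuple bool)
    a' b' (s' : a'.-tuple bool * b'.-tuple bool) : ends s = ends s' ->
  forall n, n < D ->
    twalk s n = twalk s' n /\
    twalk s ((a + b).+1 + n) = twalk s' ((a' + b').+1 + n).
Proof.
case=> eq1 eq2 n ltnD; split.
  move/(congr1 (fun w => nth ord0 w n)): eq1.
  by rewrite !(nth_map 0) ?size_iota // !nth_iota.
move/(congr1 (fun w => nth ord0 w n)): eq2.
by rewrite !(nth_map 0) ?size_iota // !nth_iota.
Qed.

(** If the second walk were shorter, reading the letters shared by its two ends inside the first
    word would give a shortcut whose period is the difference of the lengths. *)
Lemma ends_leq_length a b (s : a.-tuple bool * b.-tuple bool)
    a' b' (s' : a'.-tuple bool * b'.-tuple bool) :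
  s \in good a b -> ends s = ends s' -> a + b <= a' + b'.
Proof.
move=> good_s eq_s; rewrite leqNgt; apply/negP => lt_ab.
apply: (goodN (p := a + b - (a' + b')) good_s); first by lia.
move=> n n_in; have [|_ eqR] := ends_eq eq_s (n := n - (a' + b').+1).
  by lia.
have [|eqL _] := ends_eq eq_s (n := n); first by lia.
rewrite eqL; transitivity (twalk s' ((a' + b').+1 + (n - (a' + b').+1))).
  by congr twalk; lia.
by rewrite -eqR; congr twalk; lia.
Qed.

(** The common length is at most [D], so the two end windows cover the whole word. *)
Lemma ends_twalk_eq a b (s : a.-tuple bool * b.-tuple bool)
    a' b' (s' : a'.-tuple bool * b'.-tuple bool) :
  a + b < D -> s \in good a b -> s' \in good a' b' -> ends s = ends s' ->
  a + b = a' + b' /\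
  forall n, n < D + (a + b).+1 -> twalk s n = twalk s' n.
Proof.
move=> ltabD good_s good_s' eq_s.
have eq_ab : a + b = a' + b'.
  by apply/eqP; rewrite eqn_leq (ends_leq_length good_s eq_s)
       (ends_leq_length good_s' (esym eq_s)).
split=> // n lt_n; have [ltnD|leDn] := ltnP n D.
  by case: (ends_eq eq_s ltnD).
have [|_] := ends_eq eq_s (n := n - (a + b).+1); first by lia.
by rewrite -eq_ab subnKC //; lia.
Qed.

(** Occurrences of [e] at [a] and at [a' > a] in the same word would create a shortcut of period
    [a' - a]. *)
Lemma ends_leq_left a b (s : a.-tuple bool * b.-tuple bool)
    a' b' (s' : a'.-tuple bool * b'.-tuple bool) :
  a + b < D -> s \in good a b -> s' \in good a' b' -> ends s = ends s' ->
  a' <= a.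
Proof.
move=> ltabD good_s good_s' eq_s.
have [eq_ab eq_z] := ends_twalk_eq ltabD good_s good_s' eq_s.
rewrite leqNgt; apply/negP => lt_aa'.
apply: (goodN (p := a' - a) good_s); first by lia.
move=> n n_in; rewrite [in RHS]eq_z; last by lia.
have -> : n = a + (n - a) by lia.
have -> : a + (n - a) + (a' - a) = a' + (n - a) by lia.
by rewrite !twalk_mid //; lia.
Qed.

Lemma ends_inj a b : a + b < D -> {in good a b &, injective (@ends a b)}.
Proof.
move=> ltabD s s' good_s good_s' eq_s.
have [_ eq_z] := ends_twalk_eq ltabD good_s good_s' eq_s.
case: s s' good_s good_s' eq_s eq_z => [l r] [l' r'] _ _ _ eq_z.
congr pair; apply: val_inj; apply: (@eq_from_nth _ false);
  rewrite !size_tuple //.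
  apply: (run_inj (x := e 0)) => i le_i.
  rewrite -(@walk_left D e a (nth false l) (nth false r) i le_i).
  rewrite -(@walk_left D e a (nth false l') (nth false r') i le_i).
  by rewrite [LHS]eq_z //; lia.
apply: (run_inj (x := e D)) => i le_i.
rewrite -(@walk_right D e a (nth false l) (nth false r) i).
rewrite -(@walk_right D e a (nth false l') (nth false r') i).
by rewrite [LHS]eq_z //; lia.
Qed.

Lemma geodesic_ends a b (s : a.-tuple bool * b.-tuple bool) :
  s \in good a b -> a + b < D ->
  geodesic (@kautz_arc D) (ends s).1 (ends s).2
    (map (window D (twalk_proper s)) (iota 1 (a + b).+1)).
Proof.
move=> good_s ltabD; split; first exact: path_window.
  by rewrite [LHS]last_window.
move=> q path_q last_q; rewrite size_map size_iota leqNgt.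
move: (nth_last_path path_q); rewrite last_q.
move: (size q) => m nth_q; apply/negP => lt_m.
apply: (goodN (p := (a + b).+1 - m) good_s); first by lia.
move=> n n_in; have ltnD : n - m + m < D by lia.
have ltnD' : n - m < D by lia.
have := nth_q _ ltnD; rewrite !nth_window // => eq_n.
have -> : n + ((a + b).+1 - m) = (a + b).+1 + (n - m) by lia.
by rewrite eq_n; congr twalk; lia.
Qed.

Lemma window_mid a b (s : a.-tuple bool * b.-tuple bool) i :
  i <= 1 -> window D (twalk_proper s) (a + i) = window D pe i.
Proof.
move=> le_i1; apply: kautz_eqP => n ltnD.
by rewrite !nth_window // -addnA twalk_mid //; lia.
Qed.

Let C := [set xy : kautz D * kautz D | (xy.1 != xy.2) &&
      `[< exists p : seq (kautz D), geodesic (@kautz_arc D) xy.1 xy.2 p /\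
            uses_edge (window D pe 0, window D pe 1) xy.1 p >]].

Lemma mem_ends a b (s : a.-tuple bool * b.-tuple bool) :
  s \in good a b -> a + b < D -> ends s \in C.
Proof.
move=> good_s ltabD; have geo_s := geodesic_ends good_s ltabD.
rewrite inE; apply/andP; split.
  apply/eqP => eq_xy; case: geo_s => _ _ /(_ [::] isT eq_xy).
  by rewrite size_map size_iota.
apply/asboolP; eexists; split; first exact: geo_s.
rewrite -(window_mid s (i := 0)) // -(window_mid s (i := 1)) // addn0 addn1.
apply: (@uses_edge_window D _ (twalk_proper s) 0 (a + b).+1 a); lia.
Qed.

Lemma sum_good_leq_cong :
  \sum_(ab : 'I_D * 'I_D | ab.1 + ab.2 < D) #|good ab.1 ab.2| <=
  cong (@kautz_arc D) (window D pe 0, window D pe 1).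
Proof.
rewrite -[cong _ _]/#|C|.
have -> : \sum_(ab : 'I_D * 'I_D | ab.1 + ab.2 < D) #|good ab.1 ab.2| =
   \sum_(ab : 'I_D * 'I_D | ab.1 + ab.2 < D)
      #|@ends ab.1 ab.2 @: good ab.1 ab.2|.
  apply: eq_bigr => -[a b] /= lt_ab.
  by rewrite (card_in_imset (ends_inj lt_ab)).
apply: leq_sum_card_disjoint => [[a b] /= lt_ab | [a b] [a' b'] x /=].
  by apply/subsetP => _ /imsetP[s good_s ->]; apply: mem_ends.
move=> lt_ab lt_ab' /imsetP[s good_s ->] /imsetP[s' good_s' eq_s].
have [eq_ab _] := ends_twalk_eq lt_ab good_s good_s' eq_s.
have eq_a : a = a' :> nat.
  apply/eqP; rewrite eqn_leq (ends_leq_left lt_ab good_s good_s' eq_s).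
  by rewrite (ends_leq_left lt_ab' good_s' good_s (esym eq_s)).
by congr pair; apply: val_inj => //=; lia.
Qed.

End Count.

(** * Bounding the number of walks with a shortcut *)

Lemma card_fixed_prefixes a b (S : {set a.-tuple bool * b.-tuple bool}) m n :
  {in S &, forall s t : a.-tuple bool * b.-tuple bool,
     (forall i, i < m -> nth false s.1 i = nth false t.1 i) /\
     (forall i, i < n -> nth false s.2 i = nth false t.2 i)} ->
  #|S| <= 2 ^ ((a - m) + (b - n)).
Proof.
move=> eqS.
pose f (s : a.-tuple bool * b.-tuple bool) :=
  (drop_tuple m s.1, drop_tuple n s.2).
have f_inj : {in S &, injective f}.
  move=> s t Ss St [eqL eqR]; have [eql eqr] := eqS s t Ss St.
  case: s t {Ss St} eqL eqR eql eqr => [l r] [l' r'] /= eqL eqR eql eqr.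
  congr pair; apply: val_inj; rewrite /=.
    rewrite -(cat_take_drop m l) -(cat_take_drop m l') eqL; congr cat.
    apply: (@eq_from_nth _ false); first by rewrite !size_take !size_tuple.
    move=> i; rewrite size_take_min ltn_min => /andP[lt_i _].
    by rewrite !nth_take ?eql.
  rewrite -(cat_take_drop n r) -(cat_take_drop n r') eqR; congr cat.
  apply: (@eq_from_nth _ false); first by rewrite !size_take !size_tuple.
  move=> i; rewrite size_take_min ltn_min => /andP[lt_i _].
  by rewrite !nth_take ?eqr.
rewrite -(card_in_imset f_inj); apply: leq_trans (max_card _) _.
by rewrite card_prod !card_tuple card_bool -expnD.
Qed.

Lemma card_set_has (T : finType) (U : Type) (Q : U -> pred T) (us : seq U) :
  #|[set s | has (Q^~ s) us]| <= \sum_(u <- us) #|[set s | Q u s]|.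
Proof.
elim: us => [|u us IHus] /=.
  by rewrite big_nil leqn0 cards_eq0; apply/eqP/setP => s; rewrite !inE.
rewrite big_cons; apply: leq_trans (leq_add (leqnn _) IHus).
apply: leq_trans (leq_card_setU _ _); apply: subset_leq_card.
by apply/subsetP => s; rewrite !inE.
Qed.

(* The part of the period p imposed by a shortcut that concerns only letters of
   e. *)
Definition matches D (e : nat -> 'I_3) a b p :=
  all (fun j => e j == e (j + p))
      (iota (b.+1 - p) (minn (D - a) (D.+1 - p) - (b.+1 - p))).

(* Truncated subtraction is intended: the shortcut fixes the p - 1 - b letters
   left of e and the p - 1 - a letters right of e when these are positive. *)
Definition excess D e a b p :=
  matches D e a b p * 2 ^ ((a - (p.-1 - b)) + (b - (p.-1 - a))).

Definition total_excess D e :=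
  \sum_(0 <= a < D) \sum_(0 <= b < D - a) \sum_(1 <= p < (a + b).+2)
     excess D e a b p.

Lemma matchesP D e a b p : reflect
  (forall j, b.+1 - p <= j -> j < D - a -> j + p <= D -> e j = e (j + p))
  (matches D e a b p).
Proof.
apply: (iffP allP) => [em j j1 j2 j3 | em j].
  by apply/eqP/em; rewrite mem_iota; lia.
by rewrite mem_iota => j_in; apply/eqP/em; lia.
Qed.

(** The period carries each of the [p - 1 - b] letters left of [e], and of the [p - 1 - a] letters
    right of it, to a letter of [e]. The corresponding choices are thus forced, and only the outer
    ones remain free. *)
Lemma card_bad D e a b p : a + b < D -> 0 < p <= (a + b).+1 ->
  #|bad D e a b p| <= excess D e a b p.
Proof.
move=> lt_ab p_in; rewrite /excess; case: matchesP => [_ | no_match].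
  rewrite mul1n; apply: card_fixed_prefixes => -[l r] [l' r'].
  rewrite !inE => /shortcutP sc /shortcutP sc' /=.
  split=> i; first apply: (run_inj (x := e 0)) => {}i le_i.
    have walkE (l0 : a.-tuple bool) (r0 : b.-tuple bool) :
        (forall n, (a + b).+1 - p <= n < D ->
        twalk D e (l0, r0) n = twalk D e (l0, r0) (n + p)) ->
        run (e 0) (nth false l0) i = if i is 0 then e 0 else e (p - i).
      (* The case [i = 0] is separate because the period need not reach the letter [e 0] itself. *)
      move=> sc0; case: i le_i => [|i] le_i //.
      rewrite -(@walk_left D e a _ (nth false r0)); last by lia.
      rewrite -[LHS]/(twalk D e (l0, r0) (a - i.+1)) sc0; last by lia.
      have -> : a - i.+1 + p = a + (p - i.+1) by lia.
      by rewrite twalk_mid //; lia.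
    by rewrite (walkE _ _ sc) (walkE _ _ sc').
  apply: (run_inj (x := e D)) => {}i le_i.
  have walkE (l0 : a.-tuple bool) (r0 : b.-tuple bool) :
        (forall n, (a + b).+1 - p <= n < D ->
      twalk D e (l0, r0) n = twalk D e (l0, r0) (n + p)) ->
      run (e D) (nth false r0) i = if i is 0 then e D else e (D + i - p).
    move=> sc0; case: i le_i => [|i] le_i //.
    rewrite -(@walk_right D e a (nth false l0)).
    have -> : a + D + i.+1 = a + (D + i.+1 - p) + p by lia.
    rewrite -[LHS]/(twalk D e (l0, r0) _) -sc0; last by lia.
    by rewrite twalk_mid //; lia.
  by rewrite (walkE _ _ sc) (walkE _ _ sc').
rewrite leqn0 cards_eq0; apply/eqP/setP => s; rewrite !inE.
apply/shortcutP => sc; apply: no_match => j j1 j2 j3.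
have := sc (a + j); rewrite -addnA !twalk_mid //; last by lia.
by apply; lia.
Qed.

Lemma card_good D e a b : a + b < D ->
  2 ^ (a + b) <= #|good D e a b| +
                 \sum_(1 <= p < (a + b).+2) excess D e a b p.
Proof.
move=> lt_ab.
have <- : #|{: a.-tuple bool * b.-tuple bool}| = 2 ^ (a + b).
  by rewrite card_prod !card_tuple card_bool expnD.
rewrite -(cardC (good D e a b)) leq_add2l.
have -> : #|[predC good D e a b]| =
  #|[set s : a.-tuple bool * b.-tuple bool |
       has (fun p => shortcut D (a + b).+1 p (twalk D e s))
           (iota 1 (a + b).+1)]|.
  by apply: eq_card => s; rewrite !inE negbK.
apply: leq_trans (card_set_has _ _) _.
rewrite /index_iota subSS subn0 !big_seq; apply: leq_sum => p.
by rewrite mem_iota => p_in; apply: card_bad => //; lia.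
Qed.

Lemma sum_triangle D (F : nat -> nat -> nat) :
  \sum_(ab : 'I_D * 'I_D | ab.1 + ab.2 < D) F ab.1 ab.2 =
  \sum_(0 <= a < D) \sum_(0 <= b < D - a) F a b.
Proof.
rewrite big_mkord -(pair_big_dep xpredT (fun a b : 'I_D => a + b < D)
  (fun a b : 'I_D => F a b)) /=.
apply: eq_bigr => a _; rewrite big_mkord (big_ord_widen D) ?leq_subr //.
by apply: eq_bigl => b; rewrite ltn_subRL.
Qed.

Lemma sum_pow2 a n : \sum_(0 <= b < n) 2 ^ (a + b) + 2 ^ a = 2 ^ (a + n).
Proof.
elim: n => [|n IHn]; first by rewrite big_geq ?addn0.
by rewrite big_nat_recr //= addnAC IHn addnS expnS mul2n addnn.
Qed.

Lemma sum_pow2_triangle D : 0 < D ->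
  \sum_(0 <= a < D) \sum_(0 <= b < D - a) 2 ^ (a + b) = (D.-1) * 2 ^ D + 1.
Proof.
(* Row [a] sums to 2^D - 2^a; the missing powers are added back to avoid truncated subtraction. *)
move=> D_gt0; have sumD : \sum_(0 <= a < D) \sum_(0 <= b < D - a) 2 ^ (a + b)
    + \sum_(0 <= a < D) 2 ^ (0 + a) = D * 2 ^ D.
  have -> : D * 2 ^ D = \sum_(0 <= a < D) 2 ^ D.
    by rewrite sum_nat_const_nat subn0.
  rewrite -big_split /=.
  rewrite !big_nat; apply: eq_bigr => a /andP[_ lt_a].
  by rewrite sum_pow2 subnKC ?(ltnW lt_a).
by have := sum_pow2 0 D; rewrite expn0 add0n; nia.
Qed.

Lemma cong_lower_bound D e (pe : proper e) : 0 < D ->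
  D.-1 * 2 ^ D + 1 <=
  cong (@kautz_arc D) (window D pe 0, window D pe 1) + total_excess D e.
Proof.
move=> D_gt0; rewrite -sum_pow2_triangle //.
apply: leq_trans (leq_add (sum_good_leq_cong D_gt0 pe) (leqnn _)).
rewrite (sum_triangle D (fun a b => #|good D e a b|)) -big_split /= !big_nat.
apply: leq_sum => a _.
rewrite -big_split /= !big_nat; apply: leq_sum => b /andP[_ lt_b].
by apply: card_good; rewrite -ltn_subRL.
Qed.

Lemma cong_gt_tau D e (pe : proper e) : 4 <= D ->
  total_excess D e <= (D - 3) * 2 ^ (D - 2) ->
  tau D < cong (@kautz_arc D) (window D pe 0, window D pe 1).
Proof.
move=> D_ge4 small; have D_gt0 : 0 < D by lia.
have := cong_lower_bound pe D_gt0; rewrite /tau.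
(* With Q = 2^(D-2), [tau D] is (3D-1)Q and the number of walks is (4D-4)Q + 1. *)
have -> : 2 ^ D = 4 * 2 ^ (D - 2) by rewrite -(expnD 2 2) subnKC //; lia.
have -> : 2 ^ (D - 1) = 2 * 2 ^ (D - 2) by rewrite -expnS; congr expn; lia.
nia.
Qed.

(** * A square-free word *)

Fixpoint tm_rec (k n : nat) : bool :=
  if k is k'.+1 then odd n (+) tm_rec k' n./2 else false.

(* The Thue-Morse sequence: the parity of the binary digit sum, computed with
   the argument itself as fuel. *)
Definition tm n := tm_rec n n.

Lemma tm_rec_fuel k m n : n <= k -> n <= m -> tm_rec k n = tm_rec m n.
Proof.
elim: k m n => [|k IHk] [|m] [|n] // le_nk le_nm.
- by elim: m {le_nm}.
- by elim: k {IHk le_nk}.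
- by rewrite /= (IHk m) //; lia.
by rewrite /= (IHk m) //; lia.
Qed.

Lemma tm_half n : tm n = odd n (+) tm n./2.
Proof.
by case: n => // n; rewrite {1}/tm /= (@tm_rec_fuel n (n.+1)./2) //=; lia.
Qed.

Lemma tm_add_double i j : tm (i + j.*2) = odd i (+) tm (i./2 + j).
Proof.
have -> : i./2 + j = (i + j.*2)./2 by lia.
by rewrite tm_half oddD odd_double addbF.
Qed.

Lemma tm_even_succ n : ~~ odd n -> tm n.+1 = ~~ tm n.
Proof.
move=> n_even; rewrite tm_half (tm_half n) /= uphalf_half.
by rewrite (negbTE n_even).
Qed.

(** Descent on the period: an even period is halved, and an odd one makes [tm] alternate, so that it
    differs from itself at distance [p]. *)
Lemma tm_overlap_free i p : 0 < p ->
  ~ (forall j, j <= p -> tm (i + j) = tm (i + j + p)).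
Proof.
elim/ltn_ind: p i => p IHp i p_gt0 ov; have [p_odd | p_even] := boolP (odd p).
  (* x or x + p is even, so tm alternates over an odd period. *)
  have alt x : i <= x < i + p -> tm x.+1 = ~~ tm x.
    move=> x_in; have [x_odd | x_even] := boolP (odd x).
      2: exact: tm_even_succ.
    have := ov (x - i); have := ov (x - i).+1.
    rewrite addnS subnKC; last by lia.
    move=> ->; last by lia.
    by move=> ->; [rewrite addSn tm_even_succ ?oddD ?x_odd ?p_odd | lia].
  have tm_shift j : j <= p -> tm (i + j) = odd j (+) tm i.
    elim: j => [|j IHj] lt_jp; first by rewrite addn0.
    rewrite addnS alt; last by lia.
    by rewrite IHj ?(ltnW lt_jp) //= addNb.
  have := ov 0 isT; rewrite addn0 tm_shift // p_odd; by case: tm.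
(* Along the positions [i + j.*2] the last binary digit is constant and cancels. *)
apply: (IHp p./2 _ i./2); [lia | lia |] => j le_j.
have := ov j.*2; rewrite (_ : i + j.*2 + p = i + (j + p./2).*2); last by lia.
rewrite !tm_add_double addnA => eq_j; apply: (@addbI (odd i)); apply: eq_j; lia.
Qed.

(* Over {-1, 0, 1} this is [tm n.+1 - tm n], with 1, 0, -1 encoded as the
   letters 0, 1, 2. *)
Definition vtm n : 'I_3 :=
  if tm n == tm n.+1 then @Ordinal 3 1 isT
  else if tm n then @Ordinal 3 2 isT else ord0.

Lemma vtm_eq m n : vtm m = vtm n ->
  (tm m = tm m.+1 /\ tm n = tm n.+1) \/ (tm m = tm n /\ tm m.+1 = tm n.+1).
Proof.
rewrite /vtm; move: (tm m) (tm m.+1) (tm n) (tm n.+1).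
by move=> [] [] [] [] //=; auto.
Qed.

Definition squarefree (f : nat -> 'I_3) :=
  forall i p, 0 < p -> ~ (forall j, j < p -> f (i + j) = f (i + j + p)).

Lemma vtm_squarefree : squarefree vtm.
Proof.
move=> i p p_gt0 sq; have [eq_i | neq_i] := eqVneq (tm i) (tm (i + p)).
  (* Equal differences from equal values: tm has an overlap. *)
  apply: (tm_overlap_free (i := i) p_gt0); elim=> [|j IHj] lt_j.
    by rewrite !addn0.
  have := vtm_eq (sq j lt_j); rewrite !addnS !addSn.
  by have := IHj (ltnW lt_j) => eq_j [[<- <-] | []].
(* With unequal starting values, a nonzero increment common to both halves is impossible, since it
   determines the value it starts from. So all increments vanish and [tm] is constant from [i] to
   [i + p]. *)
have eq1 j : j <= p -> tm (i + j) = tm i /\ tm (i + j + p) = tm (i + p).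
  elim: j => [|j IHj] lt_j; first by rewrite !addn0.
  have [eq_j eq_jp] := IHj (ltnW lt_j).
  have := vtm_eq (sq j lt_j); rewrite !addnS !addSn eq_j eq_jp.
  by case=> -[eq1 eq2]; [split | rewrite eq1 eqxx in neq_i].
by have [eq_p _] := eq1 p (leqnn p); rewrite eq_p eqxx in neq_i.
Qed.

Lemma vtm_proper : proper vtm.
Proof.
move=> n; apply/eqP => eq_n; apply: (vtm_squarefree (i := n) (p := 1)) => //.
by case=> // _; rewrite addn0 addn1.
Qed.

Definition word212 n : 'I_3 := if n is 0 then @Ordinal 3 2 isT else vtm n.

Lemma word212_proper : proper word212.
Proof. by case=> [|n] //; apply: vtm_proper. Qed.

(** The letter 2 is a descent of [tm] and 1 a repetition: after a descent and a repetition the value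
    is 0, and no descent can follow. *)
Lemma vtm_no_212 n :
  ~ [/\ vtm n = vtm 2, vtm n.+1 = vtm 1 & vtm n.+2 = vtm 2].
Proof.
rewrite /vtm; move: (tm n) (tm n.+1) (tm n.+2) (tm n.+3).
by move=> [] [] [] [] [].
Qed.

Lemma word212_prefix_once p :
  0 < p -> ~ (forall j, j < 3 -> word212 j = word212 (j + p)).
Proof.
case: p => // p _ eq_p; apply: (@vtm_no_212 p.+1).
split; first exact: esym (eq_p 0 isT).
  exact: esym (eq_p 1 isT).
exact: esym (eq_p 2 isT).
Qed.

(** A square at a positive position lies in [vtm]. One at 0 of period at least 3 would repeat the
    prefix 212; periods 1 and 2 are refuted by a letter. *)
Lemma word212_squarefree : squarefree word212.
Proof.
case=> [|i] p p_gt0 sq; last first.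
  exact: (vtm_squarefree (i := i.+1) p_gt0).
case: p p_gt0 sq => [|[|[|p]]] // _ sq.
- by have := sq 0 isT.
- by have := sq 1 isT.
by apply: (@word212_prefix_once p.+3) => // j lt_j; apply: (sq j); lia.
Qed.

(** * Short words, by computation *)

(** Sums are taken in binary because the powers of two involved are too large for evaluation in
    unary [nat]. *)
Definition binsum m n (F : nat -> N) : N :=
  foldr (fun i s => N.add (F i) s) 0%num (index_iota m n).

Lemma nat_of_binsum m n (F : nat -> N) :
  nat_of_bin (binsum m n F) = \sum_(m <= i < n) nat_of_bin (F i).
Proof.
rewrite /binsum; elim: index_iota => [|i s IHs] /=; first by rewrite big_nil.
by rewrite big_cons -IHs; lia.
Qed.

Definition binpow2 n : N := iter n N.double 1%num.

Lemma nat_of_binpow2 n : nat_of_bin (binpow2 n) = 2 ^ n.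
Proof.
elim: n => //= n IHn; rewrite expnS -IHn -/(binpow2 n).
by move: (binpow2 n) => x; lia.
Qed.

Definition bin_excess D e a b p : N :=
  if matches D e a b p then binpow2 ((a - (p.-1 - b)) + (b - (p.-1 - a)))
  else 0%num.

Definition small_excess D e : bool :=
  N.leb (binsum 0 D (fun a => binsum 0 (D - a) (fun b =>
           binsum 1 (a + b).+2 (bin_excess D e a b))))
        (N.mul (bin_of_nat (D - 3)) (binpow2 (D - 2))).

Lemma small_excessP D e :
  small_excess D e -> total_excess D e <= (D - 3) * 2 ^ (D - 2).
Proof.
have -> : total_excess D e =
    nat_of_bin (binsum 0 D (fun a => binsum 0 (D - a) (fun b =>
      binsum 1 (a + b).+2 (bin_excess D e a b)))).
  rewrite nat_of_binsum; apply: eq_bigr => a _.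
  rewrite nat_of_binsum; apply: eq_bigr => b _.
  rewrite nat_of_binsum; apply: eq_bigr => p _.
  rewrite /excess /bin_excess; case: ifP => _; last by rewrite mul0n.
  by rewrite mul1n nat_of_binpow2.
rewrite /small_excess -{2}[D - 3]bin_of_natK -nat_of_binpow2.
move: (binsum _ _ _) (bin_of_nat _) (binpow2 _) => x y z /N.leb_le; lia.
Qed.

(** The edges obtained are 01210 for D = 4 and 012102 for D = 5. *)
Lemma small_excess_vtm D : 4 <= D < 6 -> small_excess D (fun n => vtm (6 + n)).
Proof.
have /allP small : all (small_excess^~ (fun n => vtm (6 + n))) (iota 4 2).
  by vm_compute.
by move=> D_in; apply: small; rewrite mem_iota.
Qed.

Lemma small_excess_word212 D : 6 <= D < 25 -> small_excess D word212.
Proof.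
have /allP small : all (small_excess^~ word212) (iota 6 19).
  by vm_compute.
by move=> D_in; apply: small; rewrite mem_iota.
Qed.

(** * Long words *)

(** Only squares within the letters 0 to D of the edge are excluded, so that the condition survives
    the reversal [D - j]. *)
Definition squarefree_upto D (f : nat -> 'I_3) :=
  forall i p, 0 < p -> i + p + p <= D.+1 ->
  ~ (forall j, j < p -> f (i + j) = f (i + j + p)).

Lemma squarefree_upto_rev D f :
  squarefree_upto D f -> squarefree_upto D (fun j => f (D - j)).
Proof.
move=> sqf i p p_gt0 le_D sq; apply: (sqf (D.+1 - (i + p + p)) p p_gt0).
  by lia.
move=> j lt_jp; have := sq (p - j.+1).
have -> : D - (i + (p - j.+1)) = D.+1 - (i + p + p) + j + p by lia.
have -> : D - (i + (p - j.+1) + p) = D.+1 - (i + p + p) + j by lia.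
by move=> -> //; lia.
Qed.

(** Geometric series; the subtracted term makes the induction close. *)
Lemma sum_tail_pow2 N s n : n <= N.+1 ->
  \sum_(0 <= p < n) (s <= p) * 2 ^ (N - p) <= 2 ^ (N.+1 - s) - 2 ^ (N.+1 - n).
Proof.
elim: n => [|n IHn] lt_nN; first by rewrite big_geq.
rewrite big_nat_recr //= subSS; have := IHn (ltnW lt_nN).
rewrite (@subSn n N) // expnS; case: (leqP s n) => [le_sn | lt_ns]; last first.
  by rewrite mul0n addn0; lia.
rewrite mul1n.
have : 2 ^ (N - n).+1 <= 2 ^ (N.+1 - s) by rewrite leq_exp2l //; lia.
by rewrite expnS; have := expn_gt0 2 (N - n); lia.
Qed.

(** The least element of [Q] gives the first term; all others lie at least [g] further and are
    bounded by a full geometric tail. *)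
Lemma sum_sparse_pow2 N lo n g (Q : pred nat) : n <= N.+1 ->
  (forall p, Q p -> lo <= p) ->
  (forall p q, p < q -> Q p -> Q q -> p + g <= q) ->
  \sum_(0 <= p < n) Q p * 2 ^ (N - p) <= 2 ^ (N - lo) + 2 ^ (N.+1 - lo - g).
Proof.
move=> le_nN Q_lo Q_gap; have [exQ | noQ] := pselect (exists p, Q p); last first.
  rewrite big1 // => p _; case: (boolP (Q p)) => // Qp.
  by case: noQ; exists p.
case: (ex_minnP exQ) => m Qm min_m.
apply: (@leq_trans (\sum_(0 <= p < n)
    ((p == m) * 2 ^ (N - m) + (m + g <= p) * 2 ^ (N - p)))).
  apply: leq_sum => p _; case: (boolP (Q p)) => // Qp.
  have := min_m p Qp; rewrite leq_eqVlt => /orP[/eqP-> | lt_mp].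
    by rewrite eqxx leq_addr.
  by rewrite (Q_gap m p) // leq_addl.
rewrite big_split /=; apply: leq_add.
  rewrite -big_distrl /=.
  have : \sum_(0 <= p < n) (p == m : nat) <= 1.
    elim: n {le_nN} => [|k IHk]; first by rewrite big_geq.
    rewrite big_nat_recr //=; case: eqP => [-> | _]; last by rewrite addn0.
    by rewrite big_nat big1 // => i /andP[_ lt_i]; rewrite ltn_eqF.
  have : 2 ^ (N - m) <= 2 ^ (N - lo) by rewrite leq_exp2l // leq_sub2l ?Q_lo.
  by nia.
apply: leq_trans (sum_tail_pow2 _ le_nN) _.
apply: leq_trans (leq_subr _ _) _; rewrite -subnDA leq_exp2l //.
by rewrite leq_sub2l // leq_add2r Q_lo.
Qed.

Lemma sum_pow4 c n : 3 * \sum_(0 <= b < n) 2 ^ (c + b.*2) <= 2 ^ (c + n.*2).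
Proof.
elim: n => [|n IHn]; first by rewrite big_geq.
by rewrite big_nat_recr //= doubleS !addnS !expnS; lia.
Qed.

Lemma leq_sum_nat m n (F G : nat -> nat) :
  (forall i, m <= i < n -> F i <= G i) ->
  \sum_(m <= i < n) F i <= \sum_(m <= i < n) G i.
Proof. by move=> leFG; rewrite !big_nat; apply: leq_sum. Qed.

(** * Recurring prefixes and suffixes of the edge *)

Section Border.
Variable D : nat.

Definition recurs (f : nat -> 'I_3) l p :=
  [&& l < p, p + l <= D.+1 & all (fun j => f j == f (j + p)) (iota 0 l)].

Lemma recurs_eq f l p j : recurs f l p -> j < l -> f j = f (j + p).
Proof.
by case/and3P=> _ _ /allP eq_f lt_j; apply/eqP/eq_f; rewrite mem_iota.
Qed.

(* The prefix of f of length D - a recurs at p; with f reversed and a, b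
   exchanged this also accounts for suffixes. *)
Definition side_excess f a b p := recurs f (D - a) p * 2 ^ (a + b.*2 + 1 - p).

(** Occurrences of the prefix at [p] and [q] with [q - p <= l] would form a square of period [q - p]
    at [p]. *)
Lemma recurs_gap f l p q : squarefree_upto D f ->
  p < q -> recurs f l p -> recurs f l q -> p + l.+1 <= q.
Proof.
move=> sqf lt_pq rec_p rec_q; rewrite leqNgt; apply/negP => lt_q.
have [_ le_q _] := and3P rec_q.
apply: (sqf p (q - p)) => [||j lt_j]; [lia | lia |].
have -> : p + j + (q - p) = j + q by lia.
by rewrite addnC -(recurs_eq rec_p) -?(recurs_eq rec_q) //; lia.
Qed.

Lemma side_excess_level f l : squarefree_upto D f -> 0 < l <= D ->
  3 * (\sum_(0 <= b < l) \sum_(0 <= p < D.+2) side_excess f (D - l) b p) <=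
  2 ^ D + 2 ^ (D - l).
Proof.
move=> sqf /andP[l_gt0 le_lD].
apply: (@leq_trans (\sum_(0 <= p < D.+2) recurs f l p * 2 ^ ((D + l).+1 - p))).
  rewrite exchange_big_nat big_distrr /=; apply: leq_sum => p _.
  rewrite /side_excess subKn // -big_distrr mulnCA leq_mul2l /=.
  case: (boolP (recurs f l p)) => // /and3P[lt_lp le_p _] /=.
  apply: leq_trans (leq_trans (sum_pow4 (D - l + 1 - p) l) _).
    by rewrite leq_mul2l /=; apply: leq_sum => b _; rewrite leq_exp2l //; lia.
  by rewrite leq_exp2l //; lia.
(* Both the first recurrence and the gaps are at least [l + 1]; with exponent base [D + l + 1] the
   two terms are 2^D and 2^(D-l). *)
apply: leq_trans (@sum_sparse_pow2 _ l.+1 _ l.+1 _ _ _ _) _; first by lia.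
- by move=> p /and3P[].
- by move=> p q; apply: recurs_gap.
by rewrite leq_add // leq_exp2l //; lia.
Qed.

Lemma side_excess_level0 f l : l <= D -> (forall p, ~~ recurs f l p) ->
  \sum_(0 <= b < l) \sum_(0 <= p < D.+2) side_excess f (D - l) b p = 0.
Proof.
move=> le_lD no_rec; rewrite big1 // => b _; rewrite big1 // => p _.
by rewrite /side_excess subKn // (negbTE (no_rec p)).
Qed.

Lemma sum_side_levels f :
  \sum_(0 <= a < D) \sum_(0 <= b < D - a) \sum_(0 <= p < D.+2)
     side_excess f a b p =
  \sum_(0 <= i < D) \sum_(0 <= b < i.+1) \sum_(0 <= p < D.+2)
     side_excess f (D - i.+1) b p.
Proof.
rewrite big_nat_rev add0n !big_nat; apply: eq_bigr => i /andP[_ lt_i].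
by rewrite subKn.
Qed.

Lemma side_excess_half f : squarefree_upto D f ->
  3 * (\sum_(0 <= a < D) \sum_(0 <= b < D - a) \sum_(0 <= p < D.+2)
     side_excess f a b p) <= (D./2).+1 * 2 ^ D.
Proof.
move=> sqf; rewrite sum_side_levels big_distrr /=.
(* The extra term 2^(D-n) absorbs the geometric remainders of the levels. *)
suff bound n : n <= D -> \sum_(0 <= i < n) 3 * (\sum_(0 <= b < i.+1)
    \sum_(0 <= p < D.+2) side_excess f (D - i.+1) b p) + 2 ^ (D - n) <=
    (minn n D./2).+1 * 2 ^ D.
  apply: leq_trans (leq_trans (bound D (leqnn D)) _); first exact: leq_addr.
  by rewrite leq_mul2r ltnS geq_minr orbT.
elim: n => [|n IHn] lt_nD; first by rewrite big_geq // subn0; lia.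
rewrite big_nat_recr //=; have := IHn (ltnW lt_nD).
have -> : 2 ^ (D - n) = 2 * 2 ^ (D - n.+1) by rewrite -expnS; congr expn; lia.
have [lt_n2 | le_2n] := ltnP n D./2.
  have := @side_excess_level f n.+1 sqf lt_nD.
  have -> : minn n.+1 D./2 = n.+1 by lia.
  rewrite !mulSn; lia.
rewrite (side_excess_level0 (f := f) lt_nD); last first.
  (* A recurrence needs 2l + 1 <= D + 1, so prefixes longer than D/2 never recur. *)
  by move=> p; apply/and3P => -[]; lia.
have -> : minn n.+1 D./2 = D./2 by lia.
rewrite !mulSn; lia.
Qed.

(** Only lengths 1 and 2 contribute: with Q = 2^(D-2) they give 4Q + 2Q and 4Q + Q. *)
Lemma side_excess_two f : squarefree_upto D f -> 2 <= D ->
  (forall l p, 3 <= l -> ~~ recurs f l p) ->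
  3 * (\sum_(0 <= a < D) \sum_(0 <= b < D - a) \sum_(0 <= p < D.+2)
     side_excess f a b p) <= 11 * 2 ^ (D - 2).
Proof.
move=> sqf D_ge2 no_rec; rewrite sum_side_levels.
have sum2 (F : nat -> nat) : (forall i, 2 <= i < D -> F i = 0) ->
    \sum_(0 <= i < D) F i = F 0 + F 1.
  move=> F0; rewrite big_ltn ?(ltnW D_ge2) // big_ltn // big_nat big1 //.
  by rewrite addn0.
rewrite sum2 => [|i /andP[lt_1i lt_iD]]; last first.
  by rewrite side_excess_level0 // => p; apply: no_rec.
have := @side_excess_level f 1 sqf (ltnW D_ge2).
have := @side_excess_level f 2 sqf D_ge2.
have -> : 2 ^ D = 4 * 2 ^ (D - 2) by rewrite -(expnD 2 2) subnKC.
have -> : 2 ^ (D - 1) = 2 * 2 ^ (D - 2) by rewrite -expnS; congr expn; lia.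
by lia.
Qed.

Lemma excess_split e a b p : squarefree_upto D e ->
  (forall q, 0 < q -> ~ (forall j, j < 3 -> e j = e (j + q))) ->
  a + b < D -> 0 < p <= (a + b).+1 ->
  excess D e a b p <=
  side_excess e a b p + side_excess (fun j => e (D - j)) b a p + 4.
Proof.
move=> sqf once lt_ab p_in; rewrite /excess.
case: matchesP => [eq_e | _] //; rewrite mul1n.
have [le_pb | lt_bp] := leqP p b.+1; have [le_pa | lt_ap] := leqP p a.+1.
(* Here the period covers a full square inside [e]. *)
- exfalso; apply: (sqf (b.+1 - p) p) => [||j lt_j]; [lia | lia |].
  by apply: eq_e; lia.
(* Here the suffix of length [D - b] recurs; recurring at distance at most its length would give a
   square. *)
- have eq_r j : j < D - b -> e (D - j) = e (D - (j + p)).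
    move=> lt_j; have := eq_e (D - (j + p)).
    have -> : D - (j + p) + p = D - j by lia.
    by move=> -> //; lia.
  have lt_Dp : D - b < p.
    rewrite ltnNge; apply/negP => le_p.
    apply: (squarefree_upto_rev sqf (i := 0) (p := p)); [lia | lia |].
    by move=> j lt_j; rewrite !add0n; apply: eq_r; lia.
  rewrite /side_excess /recurs lt_Dp (_ : p + (D - b) <= D.+1); last by lia.
  have -> : all (fun j => e (D - j) == e (D - (j + p))) (iota 0 (D - b)).
    by apply/allP => j; rewrite mem_iota => j_in; apply/eqP/eq_r; lia.
  rewrite -addnA addnCA mul1n; apply: leq_trans (leq_addr _ _).
  by rewrite leq_exp2l //; lia.
- have lt_Dp : D - a < p.
    rewrite ltnNge; apply/negP => le_p.
    apply: (sqf 0 p); [lia | lia |].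
    by move=> j lt_j; apply: eq_e; lia.
  rewrite /side_excess /recurs lt_Dp (_ : p + (D - a) <= D.+1); last by lia.
  have -> : all (fun j => e j == e (j + p)) (iota 0 (D - a)).
    by apply/allP => j; rewrite mem_iota => j_in; apply/eqP/eq_e; lia.
  rewrite -addnA mul1n; apply: leq_trans (leq_addr _ _).
  by rewrite leq_exp2l //; lia.
(* The period now exceeds both bounds, so [e] has a border of [D + 1 - p] letters, at most two by
   [once]. The exponent 2(a + b + 1 - p) is then at most 2, whence the constant 4. *)
have le_Dp : D < p + 2.
  rewrite ltnNge; apply/negP => le_pD; apply: (once p) => [|j lt_j]; first lia.
  by apply: eq_e; lia.
by apply: leq_trans (leq_addl _ _); rewrite (leq_exp2l _ 2) //; lia.
Qed.

Lemma sum_triangle_swap (F : nat -> nat -> nat) :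
  \sum_(0 <= a < D) \sum_(0 <= b < D - a) F b a =
  \sum_(0 <= a < D) \sum_(0 <= b < D - a) F a b.
Proof.
rewrite -(sum_triangle D (fun a b => F b a)) -sum_triangle.
rewrite (reindex_inj (h := fun ab : 'I_D * 'I_D => (ab.2, ab.1))) /=.
  by apply: eq_bigl => ab; rewrite addnC.
by move=> [a b] [a' b'] /= [-> ->].
Qed.

Lemma total_excess_bound e : squarefree_upto D e ->
  (forall q, 0 < q -> ~ (forall j, j < 3 -> e j = e (j + q))) ->
  25 <= D -> total_excess D e <= (D - 3) * 2 ^ (D - 2).
Proof.
move=> sqf once D_ge25.
have split_total : total_excess D e <=
   \sum_(0 <= a < D) \sum_(0 <= b < D - a) \sum_(0 <= p < D.+2)
       side_excess e a b p +
   \sum_(0 <= a < D) \sum_(0 <= b < D - a) \sum_(0 <= p < D.+2)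
       side_excess (fun j => e (D - j)) a b p + 4 * (D * D * D).
  (* The suffix terms arise with [a] and [b] exchanged, and the triangle is symmetric. *)
  rewrite -[X in _ <= _ + X + _](sum_triangle_swap (fun a b =>
    \sum_(0 <= p < D.+2) side_excess (fun j => e (D - j)) a b p)).
  have -> : 4 * (D * D * D) =
      \sum_(0 <= a < D) \sum_(0 <= b < D) \sum_(0 <= p < D) 4.
    by rewrite !sum_nat_const_nat !subn0; lia.
  rewrite -!big_split /= /total_excess.
  apply: leq_sum_nat => a /andP[_ lt_a].
  apply: (@leq_trans (\sum_(0 <= b < D - a) (\sum_(0 <= p < D.+2)
     side_excess e a b p + \sum_(0 <= p < D.+2)
       side_excess (fun j => e (D - j)) b a p + \sum_(0 <= p < D) 4))).
    apply: leq_sum_nat => b /andP[_ lt_b]; rewrite -big_split /=.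
    have sub_range (F : nat -> nat) :
        \sum_(1 <= p < (a + b).+2) F p <= \sum_(0 <= p < D.+2) F p.
      rewrite (big_cat_nat (n := (a + b).+2) (p := D.+2)) //=; last by lia.
      rewrite (big_cat_nat (m := 0) (n := 1) (p := (a + b).+2)) //=.
      by rewrite addnAC leq_addl.
    apply: (@leq_trans (\sum_(1 <= p < (a + b).+2) (side_excess e a b p +
        side_excess (fun j => e (D - j)) b a p) +
        \sum_(1 <= p < (a + b).+2) 4)).
      rewrite -big_split /=; apply: leq_sum_nat => p p_in.
      by apply: excess_split => //; lia.
    apply: leq_add; first exact: sub_range.
    by rewrite !sum_nat_const_nat; lia.
  rewrite big_split big_split /= leq_add2l !sum_nat_const_nat; nia.
have no_rec l p : 3 <= l -> ~~ recurs e l p.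
  move=> l_ge3; apply/negP => rec_e; have [lt_lp _ _] := and3P rec_e.
  apply: (once p); first exact: leq_ltn_trans lt_lp.
  by move=> j lt_j; apply: recurs_eq rec_e _; apply: leq_trans l_ge3.
have D_ge2 : 2 <= D by apply: leq_trans D_ge25.
have left_le := side_excess_two sqf D_ge2 no_rec.
have right_le := side_excess_half (squarefree_upto_rev sqf).
(* At 25 the comparison goes through 25 <= 2^5, so no large number is evaluated. *)
have cube n : 25 <= n -> 12 * (n * n * n) <= 2 ^ (n - 2).
  elim: n => // n IHn; rewrite leq_eqVlt => /orP[/eqP <- | n_ge25].
    have le25 : 25 <= 2 ^ 5 by [].
    have le12 : 12 <= 2 ^ 4 by [].
    apply: leq_trans (leq_mul le12 (leq_mul (leq_mul le25 le25) le25)) _.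
    by rewrite -!expnD leq_exp2l.
  have := IHn n_ge25.
  have -> : 2 ^ (n.+1 - 2) = 2 * 2 ^ (n - 2).
    by rewrite -expnS; congr expn; lia.
  by nia.
have cube_D := cube D D_ge25.
have half_D : 2 * D./2 <= D by lia.
have pow_D : 2 ^ D = 4 * 2 ^ (D - 2) by rewrite -(expnD 2 2) subnKC.
(* With Q = 2^(D-2), the three parts are at most 11Q, (2D + 4)Q and Q, and 2D + 16 <= 3(D - 3) holds
   exactly from D = 25 on. *)
rewrite -(leq_pmul2l (isT : 0 < 3)).
apply: leq_trans (leq_mul (leqnn 3) split_total) _; rewrite !mulnDr.
apply: leq_trans (leq_add (leq_add left_le right_le) (leqnn _)) _.
by rewrite pow_D; nia.
Qed.

End Border.

Theorem theorem6p7 (D : nat) (hD : 4 <= D) :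
  exists e : kautz D * kautz D,
    kautz_arc e.1 e.2 /\ tau D < cong (@kautz_arc D) e.
Proof.
have D_gt0 : 0 < D by exact: leq_trans hD.
have [lt_D6 | le_6D] := ltnP D 6.
  have pe : proper (fun n => vtm (6 + n)) by move=> n; apply: vtm_proper.
  exists (window D pe 0, window D pe 1); split; first exact: kautz_arc_window.
  by apply: cong_gt_tau => //; apply/small_excessP/small_excess_vtm/andP.
exists (window D word212_proper 0, window D word212_proper 1).
split; first exact: kautz_arc_window.
apply: cong_gt_tau => //; have [lt_D25 | le_25D] := ltnP D 25.
  exact/small_excessP/small_excess_word212/andP.
apply: total_excess_bound => //.
  by move=> i p p_gt0 _; apply: word212_squarefree.
by move=> q; apply: word212_prefix_once.
Qed.
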